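(* Let $H$ be a bipartite graph with no vertices of degree $1$, let $0 < a < \frac{1}{3}$ and $K > 0$. Suppose that for infinitely many $n$ there exists an $H$-free $d$-regular graph $G$ on $n$ vertices with $d = n^{a}$ and $\rho(G) \le K d^{1/2}$ (i.e. $\rho = O(d^{1/2})$). Then there exists an absolute constant $C$ such that for all such $n$ that are sufficiently large, \[ f(m,H) \leq C\, m^{\frac{2}{1+a} - 1} (\log m)^{\frac{1}{1+a}}, \qquad \text{where } m = \frac{1}{4}\, \frac{n^{\frac{1+a}{2}}}{(\log n)^{1/2}}. \]
   Context: For a graph $G$ on $n$ vertices with adjacency eigenvalues $\rho_1 \ge \rho_2 \ge \cdots \ge \rho_n$, set $\rho(G) = \max\{\rho_2, -\rho_n\}$ if $G$ is not bipartite and $\rho(G) = \rho_2$ if $G$ is bipartite. Let $r,k$ be positive integers. A graph is an $(r,k)$-graph if its vertex set can be partitioned into sets $V_1,\dots,V_r$ with $|V_i| \le k$ for all $i$ such that for every pair $i \neq j$ there is an edge with one endpoint in $V_i$ and the other in $V_j$. For a graph $H$, $f(r,H)$ is the minimum $k$ such that there exists an $H$-free $(r,k)$-graph. (As in the paper, $m$ and quantities like $n^a$ are treated as integers, ignoring rounding.) *)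

(* Defs.v *)
From mathcomp Require Import all_boot all_order all_algebra.
From mathcomp Require Import classical_sets cardinality reals exp polyrcf.

Set Implicit Arguments.
Unset Strict Implicit.
Unset Printing Implicit Defensive.
Import Order.TTheory GRing.Theory Num.Theory.
Local Open Scope ring_scope.

Record sgraph := SGraph {
  vertex :> finType;
  adj : rel vertex;
  adj_sym : symmetric adj;
  adj_irrefl : irreflexive adj }.

Definition degree (G : sgraph) (x : G) : nat := #|[set y | adj x y]|.

Definition regular (d : nat) (G : sgraph) : Prop :=
  forall x : G, degree x = d.

Definition bipartite (G : sgraph) : bool :=
  [exists c : {ffun G -> bool},
    [forall x, forall y, adj x y ==> (c x != c y)]].

(* Not necessarily induced subgraphs. *)
Definition is_free (H G : sgraph) : Prop :=
  ~ exists f : H -> G,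
      injective f /\ forall x y, adj x y -> adj (f x) (f y).

Section Spectrum.
Variables (R : realType) (G : sgraph).

Definition adjmx : 'M[R]_#|G| :=
  \matrix_(i, j) (adj (enum_val i) (enum_val j))%:R.

(* rootsR lists the distinct real roots.  As adjmx is real symmetric, all its
   eigenvalues are real, so that this list has #|G| entries. *)
Definition eigenvalues : seq R :=
  sort >=%R
    (flatten [seq nseq (mup x (char_poly adjmx)) x
             | x <- rootsR (char_poly adjmx)]).

(* Indices start at 0, so the i-th largest eigenvalue is at position i.-1. *)
Definition eig (i : nat) : R := nth 0 eigenvalues i.-1.

Definition rho : R :=
  if bipartite G then eig 2 else Num.max (eig 2) (- eig #|G|).

End Spectrum.

(* The parts are the fibres of c. *)
Definition rk_graph (r k : nat) (G : sgraph) : Prop :=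
  exists c : G -> 'I_r,
    (forall i, (#|[set x | c x == i]| <= k)%N) /\
    (forall i j, i != j -> exists x y, [/\ c x = i, c y = j & adj x y]).

Definition has_free_rk (r : nat) (H : sgraph) (k : nat) : Prop :=
  (0 < k)%N /\ exists G : sgraph, is_free H G /\ rk_graph r k G.

(* f(r, H) = k.  A relation, since f(r, H) is undefined when no H-free
   (r, k)-graph exists for any k. *)
Definition f_is (r : nat) (H : sgraph) (k : nat) : Prop :=
  has_free_rk r H k /\ forall k', has_free_rk r H k' -> (k <= k')%N.

(* k is x rounded up or down to an integer; k = x if x is an integer. *)
Definition rounds (R : realType) (k : nat) (x : R) : Prop := `|k%:R - x| < 1.

(* n is the order of an H-free d-regular graph G with d = n^a and
   rho(G) <= K d^(1/2). *)
Definition good_order (R : realType) (H : sgraph) (a K : R) (n : nat) : Prop :=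
  exists (G : sgraph) (d : nat),
    [/\ #|G| = n, is_free H G, regular d G, rounds d (n%:R `^ a)
      & rho R G <= K * Num.sqrt d%:R].

(* Main.v *)
(* Colour the n vertices of G independently and uniformly with m colours.
   Exposing a colour class A one vertex at a time and following
   E e^(-|N(A)|/m) shows that, as long as d <= 2m, two given classes span no
   edge with probability at most e^(-n(d-8)/(4m^2)). For the given m this is
   at most n^(-4/3), while there are at most m^2 <= n^(4/3)/10 pairs, and
   a < 1/3 makes n/m so large that with high probability no class has more
   than 4(n/m+1) vertices. *)

Require Import Defs.
From mathcomp Require Import all_boot all_order all_algebra.
From mathcomp Require Import classical_sets cardinality reals exp.
From mathcomp Require Import sequences finset zify ring lra.

Set Implicit Arguments.
Unset Strict Implicit.
Unset Printing Implicit Defensive.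
Import Order.TTheory GRing.Theory Num.Theory.
Local Open Scope ring_scope.

(** * The neighbourhood of a random vertex set: an exponential moment bound *)

Definition nbr (G : sgraph) (x : G) : {set G} := [set y | adj x y].
Definition nbrs (G : sgraph) (A : {set G}) : {set G} :=
  \bigcup_(x in A) nbr x.

Lemma sum_subsetU1 (R : nmodType) (T : finType) (P : {set T}) (x : T)
    (F : {set T} -> R) : x \notin P ->
  \sum_(A : {set T} | A \subset x |: P) F A
  = \sum_(A : {set T} | A \subset P) (F A + F (x |: A)).
Proof.
move=> xP; have subP (A : {set T}) :
    (A \subset P) = (A \subset x |: P) && (x \notin A).
  by rewrite -subsetD1 setU1K.
rewrite big_split /= (bigID (fun A : {set T} => x \in A)) /= addrC.
congr (_ + _); first by apply: eq_bigl => A; rewrite subP.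
rewrite (reindex_onto (fun A => x |: A) (fun A => A :\ x)) /=; last first.
  by move=> A /andP[_ xA]; rewrite setD1K.
apply: eq_bigl => A; rewrite setU11 andbT subP subUset sub1set setU11 /=.
congr andb; apply/eqP/idP => [<-|]; first by rewrite setD11.
exact: setU1K.
Qed.

(** On [0, 1] one has (1 - x/2)(1 + x) >= 1, while 1 + x <= e^x. *)
Lemma expRN_le (R : realType) (x : R) :
  0 <= x -> x <= 1 -> expR (- x) <= 1 - x / 2.
Proof.
move=> x0 x1; have h := expR_ge1Dx x.
have e0 := expR_gt0 (- x).
have : expR x * expR (- x) = 1 by exact: expRxMexpNx_1.
by nra.
Qed.

Lemma expR1_le4 (R : realType) : expR 1 <= 4 :> R.
Proof.
have h := expR_ge1Dx (- (1 / 2) : R).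
have e0 := expR_gt0 (1 / 2 : R).
have e1 : expR (1 / 2 : R) * expR (- (1 / 2)) = 1 by exact: expRxMexpNx_1.
have -> : 1 = 1 / 2 + 1 / 2 :> R by field.
rewrite expRD; set x := expR _ in e0 e1 *; set y := expR _ in h e1.
have x2 : x <= 2 by nra.
by nra.
Qed.

(* The weight of A as a q-random subset of P, times e^(q|A|): this factor pays
   for the points of A which are themselves neighbours of A. *)
Definition wt (R : realType) (G : sgraph) (q : R) (P A : {set G}) : R :=
  \prod_(x in P) (if x \in A then q * expR q else 1 - q).

(* The effect of exposing one vertex x: k is the number of neighbours of x not
   yet adjacent to A, and D the sum of their numbers of unexposed neighbours. *)
Lemma exposure_step (R : realType) (q d k D : R) :
  0 <= q -> q <= 1 / 2 -> d * q <= 2 -> 0 <= k -> k <= d -> D <= k * d ->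
  1 - q + q * expR q * expR (- (q * k) + q ^+ 2 / 4 * D)
  <= expR (- (q ^+ 2 / 4 * k) + 2 * q ^+ 2).
Proof.
move=> q0 q2 dq k0 kd Dk.
have kq : k * q <= 2 by apply: le_trans dq; rewrite ler_wpM2r.
have kq0 : 0 <= k * q by rewrite mulr_ge0.
(* Since D <= kd and dq <= 2, the second-order term is at most qk/2, half of the gain qk. The
   remaining exponent -qk/2 lies in [-1, 0], where [expRN_le] applies. *)
have h1 : expR (- (q * k) + q ^+ 2 / 4 * D) <= 1 - q * k / 2 / 2.
  apply: (@le_trans _ _ (expR (- (q * k / 2)))).
    rewrite ler_expR.
    have : q ^+ 2 * D <= q ^+ 2 * (k * d) by rewrite ler_wpM2l // exprn_ge0.
    have : (k * q) * (d * q) <= (k * q) * 2 by rewrite ler_wpM2l.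
    by rewrite expr2; lra.
  by apply: expRN_le; lra.
have h2 : expR q <= 1 + 2 * q.
  have h := expR_ge1Dx (- q).
  have e0 := expR_gt0 q.
  have e1 : expR q * expR (- q) = 1 by exact: expRxMexpNx_1.
  have e2 : expR q * (1 - q) <= 1 by rewrite -[leRHS]e1 ler_wpM2l // ltW.
  have q1 : 0 < 1 - q by lra.
  rewrite -(ler_pM2r q1); apply: (le_trans e2).
  have q3 : 0 <= 1 - 2 * q by lra.
  by have := mulr_ge0 q0 q3; lra.
apply: le_trans (expR_ge1Dx _).
have e0 := expR_gt0 (- (q * k) + q ^+ 2 / 4 * D).
have e1 := expR_gt0 q.
set X := expR (- _ + _) in h1 e0 *; set Y := expR q in h2 e1 *.
have hXY : Y * X <= (1 + 2 * q) * (1 - q * k / 2 / 2).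
  by apply: ler_pM => //; exact: ltW.
(* Dropping the negative cross term bounds the left side of the goal by 1 - q^2 k/4 + 2q^2, which is
   one plus the target exponent. *)
have : (1 + 2 * q) * (1 - q * k / 2 / 2) <= 1 - q * k / 4 + 2 * q by nra.
move=> h3; have h4 := le_trans hXY h3.
have : q * (Y * X) <= q * (1 - q * k / 4 + 2 * q) by rewrite ler_wpM2l.
by rewrite expr2 mulrA; lra.
Qed.

(** Induction on the set [P] of unexposed vertices; [U] holds the neighbours of the vertices already
    put into A. The potential is the number of pairs (y, z) of adjacent vertices with y outside [U]
    and z in [P]. Exposing x lowers it by k when x is rejected, and by k + D when x is accepted, but
    then |U| also grows by k. [exposure_step] averages the two outcomes at a cost of 2q^2 per
    vertex. *)
Lemma random_nbrs (R : realType) (G : sgraph) (d : nat) (q : R)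
    (P U : {set G}) :
  regular d G -> 0 <= q -> q <= 1 / 2 -> d%:R * q <= 2 ->
  \sum_(A : {set G} | A \subset P) wt q P A * expR (- (q * #|U :|: nbrs A|%:R))
  <= expR (- (q * #|U|%:R)
           - q ^+ 2 / 4 * \sum_(y in ~: U) #|nbr y :&: P|%:R
           + 2 * q ^+ 2 * #|P|%:R).
Proof.
move=> Gd q0 q2 dq; have [p] := ubnP #|P|; elim: p => // p IH in P U *.
rewrite ltnS => Pp.
have [->|[x xP]] := set_0Vmem P.
  rewrite (eq_bigl (pred1 set0)); last by move=> A; rewrite subset0.
  rewrite big_pred1_eq /wt /nbrs !big_set0 mul1r setU0 cards0.
  rewrite big1 => [|y _]; last by rewrite setI0 cards0.
  by rewrite !mulr0 subr0 addr0.
rewrite -(setD1K xP) in Pp *; set Q := P :\ x in Pp *.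
have xQ : x \notin Q by rewrite setD11.
rewrite cardsU1 xQ add1n in Pp.
rewrite sum_subsetU1 // big_split /=.
pose S (W : {set G}) : R := \sum_(y in ~: W) #|nbr y :&: Q|%:R.
pose V := U :|: nbr x.
have -> : \sum_(A : {set G} | A \subset Q)
    wt q (x |: Q) A * expR (- (q * #|U :|: nbrs A|%:R)) =
  (1 - q) * \sum_(A : {set G} | A \subset Q)
    wt q Q A * expR (- (q * #|U :|: nbrs A|%:R)).
  rewrite big_distrr /=; apply: eq_bigr => A AQ.
  rewrite /wt big_setU1 //=.
  have /negPf -> : x \notin A by apply: contra xQ; exact: (fintype.subsetP AQ).
  by rewrite -mulrA.
have -> : \sum_(A : {set G} | A \subset Q)
    wt q (x |: Q) (x |: A) * expR (- (q * #|U :|: nbrs (x |: A)|%:R)) =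
  q * expR q * \sum_(A : {set G} | A \subset Q)
    wt q Q A * expR (- (q * #|V :|: nbrs A|%:R)).
  rewrite big_distrr /=; apply: eq_bigr => A AQ.
  rewrite /wt big_setU1 //= setU11.
  have xA : x \notin A by apply: contra xQ; exact: (fintype.subsetP AQ).
  rewrite /nbrs big_setU1 //= setUA -!mulrA; congr (_ * (_ * (_ * _))).
  apply: eq_bigr => z zQ; rewrite in_setU1.
  by case: eqP => // zx; rewrite zx (negPf xQ) in zQ.
have IH1 := IH _ U Pp; have IH2 := IH _ V Pp.
have q1 : 0 <= 1 - q by lra.
have qe : 0 <= q * expR q by rewrite mulr_ge0 // expR_ge0.
apply: (le_trans (lerD (ler_wpM2l q1 IH1) (ler_wpM2l qe IH2))).
pose k := #|nbr x :\: U|.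
pose D : R := \sum_(y in nbr x :\: U) #|nbr y :&: Q|%:R.
have cV : #|V| = (#|U| + k)%N.
  by rewrite /V /k cardsU cardsD setIC addnBA // subset_leq_card ?subsetIl.
(* By symmetry of adjacency, x is a neighbour of exactly k vertices outside [U]. *)
have SU : \sum_(y in ~: U) #|nbr y :&: (x |: Q)|%:R = S U + k%:R :> R.
  have nQ (y : G) : #|nbr y :&: (x |: Q)| = (#|nbr y :&: Q| + adj x y)%N.
    rewrite addnC (cardsD1 x) !inE eqxx andbT adj_sym; congr addn.
    by apply: eq_card => z; rewrite !inE; case: eqVneq => [->|];
      rewrite ?(negPf xQ) ?andbF.
  rewrite (eq_bigr _ (fun y _ => congr1 (fun i => i%:R) (nQ y))).
  rewrite -!natr_sum big_split /= natrD /S natr_sum /k -sum1_card.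
  congr (_ + _%:R); rewrite [RHS]big_mkcond [LHS]big_mkcond /=.
  by apply: eq_bigr => y _; rewrite !inE; case: (y \in U); case: (adj x y).
have SV : S U = S V + D.
  rewrite /S /D addrC (big_setID (nbr x)) /=; congr (_ + _).
    by apply: eq_bigl => y; rewrite !inE andbC.
  by apply: eq_bigl => y; rewrite !inE negb_or andbC.
have kd : (k <= d)%N.
  by rewrite -(Gd x) /degree; apply: subset_leq_card; exact: subsetDl.
have Dk : D <= k%:R * d%:R.
  rewrite /D /k -natrM -natr_sum ler_nat -sum_nat_const.
  apply: leq_sum => y _; rewrite -(Gd y) /degree.
  by apply: subset_leq_card; exact: subsetIl.
(* [T] is the induction bound for [U] and [Q]. It factors out of both outcomes and of the target,
   and what is left is [exposure_step]. *)
set T := expR (_ + 2 * q ^+ 2 * #|Q|%:R).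
rewrite [X in _ + _ * X](_ : _ = T * expR (- (q * k%:R) + q ^+ 2 / 4 * D));
  last first.
  by rewrite -expRD cV; congr expR; rewrite -!/(S _) SV natrD; ring.
rewrite [leRHS](_ : _ = T * expR (- (q ^+ 2 / 4 * k%:R) + 2 * q ^+ 2));
  last first.
  by rewrite -expRD SU cardsU1 xQ add1n -natr1; congr expR; rewrite -!/(S _);
    ring.
rewrite [leLHS](_ : _ = T * (1 - q + q * expR q *
  expR (- (q * k%:R) + q ^+ 2 / 4 * D))); last by ring.
rewrite ler_wpM2l ?expR_ge0 //.
by apply: exposure_step Dk => //; rewrite ler_nat.
Qed.

(** With nothing exposed yet, regularity makes the potential equal to nd; the error 2q^2 n turns d
    into d - 8. *)
Lemma random_nbrs_setT (R : realType) (G : sgraph) (d : nat) (q : R) :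
  regular d G -> 0 <= q -> q <= 1 / 2 -> d%:R * q <= 2 ->
  \sum_(A : {set G}) wt q [set: G] A * expR (- (q * #|nbrs A|%:R))
  <= expR (- (q ^+ 2 / 4 * (#|G|%:R * (d%:R - 8)))).
Proof.
move=> Gd q0 q2 dq; have := random_nbrs [set: G] set0 Gd q0 q2 dq.
rewrite (eq_bigl xpredT); last by move=> A; rewrite subsetT.
rewrite (eq_bigr (fun A => wt q [set: G] A * expR (- (q * #|nbrs A|%:R))));
  last first.
  by move=> A _; rewrite set0U.
move=> /le_trans; apply; rewrite ler_expR cards0 mulr0 oppr0 add0r setC0.
rewrite (eq_bigr (fun=> d%:R)); last first.
  by move=> y _; rewrite setIT -(Gd y).
rewrite sumr_const cardsT -mulr_natl.
by rewrite le_eqVlt; apply/orP; left; apply/eqP; field.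
Qed.

(** * Random colourings: missing edges, large classes and the union bound *)

Lemma prod_expRN (R : realType) (T : finType) (q : R) (S : {set T}) :
  \prod_(y : T) (if y \in S then expR (- q) else 1) = expR (- (q * #|S|%:R)).
Proof.
by rewrite -big_mkcond prodr_const -expRM_natl mulrC mulNr.
Qed.

Definition no_edge (G : sgraph) m (i j : 'I_m) (c : {ffun G -> 'I_m}) : bool :=
  [forall x, forall y, (c x == i) && (c y == j) ==> ~~ adj x y].

(** Fix the class A of colour i: there is no edge to colour j exactly when every vertex of N(A)
    avoids j. For fixed A the probability is a product over the vertices, compared factor by factor
    with [wt] times e^(-q|N(A)|), where q = 1/m. *)
Lemma no_edge_prob (R : realType) (G : sgraph) (d m : nat) (i j : 'I_m) :
  regular d G -> (1 < m)%N -> (d <= 2 * m)%N -> i != j ->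
  \sum_(c : {ffun G -> 'I_m} | no_edge i j c) (m%:R^-1 ^+ #|G| : R)
  <= expR (- (m%:R^-1 ^+ 2 / 4 * (#|G|%:R * (d%:R - 8)))).
Proof.
move=> Gd m1 dm ij; set q : R := m%:R^-1.
have m0 : 0 < m%:R :> R by rewrite ltr0n; lia.
have q0 : 0 <= q by rewrite invr_ge0 ltW.
have mq : m%:R * q = 1 by rewrite mulfV // gt_eqF.
have q2 : q <= 1 / 2.
  have m2 : (2 : R) <= m%:R by rewrite ler_nat.
  by rewrite /q -div1r ler_pdivrMr //; lra.
have dq : d%:R * q <= 2.
  by rewrite /q ler_pdivrMr // -natrM ler_nat.
apply: le_trans (random_nbrs_setT Gd q0 q2 dq).
rewrite (partition_big (fun c : {ffun G -> 'I_m} => [set x | c x == i]) xpredT)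
  //=.
apply: ler_sum => A _.
(* [F y] collects the colours open to y once the class of i is A; choices at distinct vertices are
   then independent, so the sum factors. *)
pose F (y : G) := [pred l : 'I_m | if y \in A then l == i else
  (l != i) && ((y \in nbrs A) ==> (l != j))].
apply: (@le_trans _ _ (\sum_(c in family F) q ^+ #|G|)).
  rewrite [leLHS]big_mkcond [leRHS]big_mkcond /=; apply: ler_sum => c _.
  case: ifP => [/andP[/forallP nij /eqP cA]|_]; last first.
    by case: ifP => // _; rewrite exprn_ge0.
  suff -> : c \in family F by [].
  apply/familyP => y; rewrite !inE; have := erefl (y \in A).
  rewrite -{1}cA inE => <-; case: (boolP (c y == i)) => //= cyi.
  apply/implyP => /bigcupP[x]; rewrite -cA !inE => cxi xy.
  by have /forallP/(_ y) := nij x; rewrite cxi /= xy implybF.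
rewrite (_ : \sum_(c in family F) q ^+ #|G| =
  \prod_(y : G) \sum_(l | l \in F y) q); last first.
  rewrite bigA_distr_big_dep /=; apply: eq_bigr => c _.
  by rewrite prodr_const.
rewrite -prod_expRN /wt [X in _ <= X * _](eq_bigl xpredT);
  last by move=> y; rewrite inE.
rewrite -big_split /=; apply: ler_prod => y _.
rewrite sumr_ge0 //= sumr_const.
have q1 := expR_ge1Dx (- q).
have e1 := expR_ge1Dx q.
(* On A the probability is q; when y also lies in N(A), the factor e^q in [wt] cancels e^(-q). *)
have [yA|yA] := boolP (y \in A).
  rewrite (eq_card (B := pred1 i)) ?card1 => [|l]; last by rewrite !inE yA.
  case: ifP => _; last by rewrite mulr1 ler_peMr //; lra.
  by rewrite -mulrA expRxMexpNx_1 mulr1.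
have [yN|yN] := boolP (y \in nbrs A); last first.
  rewrite (eq_card (B := predC1 i)) => [|l];
    last by rewrite !inE (negPf yA) (negPf yN) andbT.
  rewrite cardC1 card_ord mulr1 -subn1 mulrnBr ?(ltnW m1) //.
  by rewrite -mulr_natl mq.
(* Two colours are excluded here, and 1 - 2q <= (1 - q)^2 <= (1 - q)e^(-q). *)
rewrite (eq_card (B := predC (pred2 i j))) => [|l]; last first.
  by rewrite !inE (negPf yA) yN negb_or.
have -> : #|predC (pred2 i j)| = (m - 2)%N.
  by rewrite -[in RHS](card_ord m) -(cardC (pred2 i j)) card2 ij addKn.
rewrite mulrnBr // -mulr_natl mq mulr2n.
have q3 : 0 <= 1 - q by lra.
have := ler_wpM2l q3 q1; nra.
Qed.

(** Markov's inequality for 2^|class|: its expectation is (1 + 1/m)^|T| <= e^(|T|/m) <= e^s <= 4^s,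
    whereas a class of more than 4s points contributes at least 16^s. *)
Lemma class_size_prob (R : realType) (T : finType) (m s : nat) (i : 'I_m) :
  (#|T| <= m * s)%N ->
  \sum_(c : {ffun T -> 'I_m} | (4 * s < #|[set x | c x == i]|)%N)
    (m%:R^-1 ^+ #|T| : R) <= (4 ^+ s)^-1.
Proof.
move=> Tms; have m0 : 0 < m%:R :> R by rewrite ltr0n; case: (m) i => [[]|].
set q : R := m%:R^-1.
have q0 : 0 <= q by rewrite invr_ge0 ltW.
have mq : m%:R * q = 1 by rewrite mulfV // gt_eqF.
have S : \sum_(c : {ffun T -> 'I_m}) q ^+ #|T| * 2 ^+ #|[set x | c x == i]|
         <= 4 ^+ s.
  rewrite (eq_bigr (fun c : {ffun T -> 'I_m} =>
      \prod_x (q * if c x == i then 2 else 1))); last first.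
    move=> c _; rewrite big_split /= prodr_const -big_mkcond /= prodr_const.
    by congr (_ * _ ^+ _); apply: eq_card => x; rewrite !inE.
  rewrite -(bigA_distr_bigA (fun _ l => q * if l == i then 2 else 1)) /=.
  rewrite prodr_const -big_distrr /= (bigD1 i) //= eqxx.
  rewrite (eq_bigr (fun=> 1)) => [|l /negPf -> //].
  rewrite sumr_const cardC1 card_ord.
  have -> : q * (2 + 1 *+ m.-1) = 1 + q.
    rewrite -subn1 natrB; last by case: (m) i => [[]|].
    by rewrite mulrDr mulrBr [q * m%:R]mulrC mq; ring.
  apply: (@le_trans _ _ (expR q ^+ #|T|)).
    by rewrite lerXn2r ?nnegrE ?expR_ge0 ?expR_ge1Dx // addr_ge0.
  apply: (@le_trans _ _ (expR 1 ^+ s)); last first.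
    by rewrite lerXn2r ?nnegrE ?expR_ge0 ?expR1_le4.
  rewrite -!expRM_natl ler_expR mulr1 /q ler_pdivrMr // -natrM ler_nat.
  by rewrite mulnC.
have s0 : 0 < 4 ^+ s :> R by rewrite exprn_gt0.
apply: (@le_trans _ _ (4 ^+ s / (16 ^+ s))); last first.
  have -> : 16 = 4 * 4 :> R by rewrite -natrM.
  by rewrite exprMn invfM mulrA mulfV ?gt_eqF // mul1r.
rewrite ler_pdivlMr ?exprn_gt0 //; apply: le_trans S.
rewrite mulr_suml [leLHS]big_mkcond /=; apply: ler_sum => c _.
case: ifP => [lt_s|_]; last by rewrite mulr_ge0 // exprn_ge0.
rewrite ler_wpM2l ?exprn_ge0 //.
have -> : 16 = 2 ^+ 4 :> R by rewrite -natrX.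
by rewrite -exprM ler_eXn2l ?ltr1n // ltnW.
Qed.

(** Union bound over at most m^2 ordered pairs of colours and m classes. If every colouring were
    bad, the total weight 1 would be at most the sum of the failure probabilities. *)
Lemma exists_rk_graph (R : realType) (G : sgraph) (d m s : nat) :
  regular d G -> (1 < m)%N -> (d <= 2 * m)%N -> (#|G| <= m * s)%N ->
  m%:R ^+ 2 * expR (- (m%:R^-1 ^+ 2 / 4 * (#|G|%:R * (d%:R - 8))))
    + m%:R * (4 ^+ s)^-1 < 1 :> R ->
  rk_graph m (4 * s) G.
Proof.
move=> Gd m1 dm Gms; set e1 := expR _; set e2 := (4 ^+ s)^-1 => lt1.
pose bad (c : {ffun G -> 'I_m}) :=
  [exists p : 'I_m * 'I_m, (p.1 != p.2) && no_edge p.1 p.2 c]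
  || [exists i, (4 * s < #|[set x | c x == i]|)%N].
have [/existsP[c]|/existsPn allbad] := boolP [exists c, ~~ bad c].
  rewrite negb_or => /andP[/existsPn h1 /existsPn h2]; exists c; split.
    by move=> i; rewrite leqNgt.
  move=> i j ij; have := h1 (i, j); rewrite /= ij /=.
  case/forallPn=> x /forallPn[y]; rewrite negb_imply negbK.
  by case/andP=> /andP[/eqP cx /eqP cy] xy; exists x, y.
exfalso; move: lt1; apply/negP; rewrite -leNgt.
pose w : R := m%:R^-1 ^+ #|G|.
have w0 : 0 <= w by rewrite exprn_ge0 // invr_ge0.
rewrite [leLHS](_ : 1 = \sum_(c : {ffun G -> 'I_m}) w); last first.
  rewrite sumr_const card_ffun card_ord -mulr_natl natrX -exprMn mulfV ?expr1n
    //.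
  by rewrite pnatr_eq0; lia.
apply: (@le_trans _ _ (\sum_(c : {ffun G -> 'I_m})
  (\sum_(p : 'I_m * 'I_m | p.1 != p.2) (if no_edge p.1 p.2 c then w else 0)
   + \sum_i (if (4 * s < #|[set x | c x == i]|)%N then w else 0)))).
  apply: ler_sum => c _; have := allbad c; rewrite negbK.
  case/orP=> [/existsP[p /andP[p12 pc]]|/existsP[i ic]].
    rewrite (bigD1 p) //= pc -addrA lerDl addr_ge0 // sumr_ge0 //.
      by move=> ? _; case: ifP.
    by move=> ? _; case: ifP.
  rewrite [X in _ + X](bigD1 i) //= ic addrCA lerDl addr_ge0 // sumr_ge0 //.
    by move=> ? _; case: ifP.
  by move=> ? _; case: ifP.
rewrite big_split /= exchange_big [X in _ + X]exchange_big /=; apply: lerD.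
  apply: (@le_trans _ _ (\sum_(p : 'I_m * 'I_m | p.1 != p.2) e1)).
    by apply: ler_sum => p p12; rewrite -big_mkcond; exact: no_edge_prob.
  rewrite big_mkcond; apply: (@le_trans _ _ (\sum_(p : 'I_m * 'I_m) e1)).
    by apply: ler_sum => p _; case: ifP => // _; exact: expR_ge0.
  by rewrite sumr_const card_prod card_ord -[leLHS]mulr_natl natrM expr2.
apply: (@le_trans _ _ (\sum_(i < m) e2)).
  by apply: ler_sum => i _; rewrite -big_mkcond; exact: class_size_prob.
by rewrite sumr_const card_ord -[leLHS]mulr_natl.
Qed.

(** * Numerical estimates, with X for n and x for m *)

Lemma large_estimates (R : realType) (a X : R) :
  0 < a -> Num.max (384 ^+ 6) (100 `^ a^-1) <= X ->
  [/\ 1 <= ln X, 100 <= X `^ a & 64 * ln X <= X `^ (1 / 3)].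
Proof.
move=> a0; rewrite ge_max => /andP[X1 X2].
have X4 : 4 <= X by apply: le_trans X1; rewrite -natrX ler_nat.
have X0 : 0 < X by apply: lt_le_trans X4.
split.
- by rewrite -ler_expR lnK ?posrE //; apply: le_trans X4; exact: expR1_le4.
- rewrite [leLHS](_ : 100 = (100 `^ a^-1) `^ a); last first.
    by rewrite -powRrM mulVf ?gt_eqF // powRr1.
  by apply: ge0_ler_powR; rewrite ?nnegrE ?powR_ge0 ?(ltW X0) ?(ltW a0).
(* The constant is 384 = 64 * 6: since ln X < 6 X^(1/6), one gets 64 ln X <= 384 X^(1/6) <=
   X^(1/3). *)
- have six : (384 : R) <= X `^ (1 / 6).
    rewrite [leLHS](_ : _ = (384 ^+ 6) `^ (1 / 6)); last first.
      by rewrite -powR_mulrn // -powRrM [_ * _](_ : _ = 1) ?powRr1 //; field.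
    by apply: ge0_ler_powR; rewrite ?nnegrE ?exprn_ge0 ?divr_ge0 ?(ltW X0).
  have := ln_sublinear (powR_gt0 (1 / 6) X0); rewrite ln_powR => lnX.
  have -> : X `^ (1 / 3) = X `^ (1 / 6) * X `^ (1 / 6).
    by rewrite -powRD ?(gt_eqF X0) ?implybT //; congr (_ `^ _); field.
  by nra.
Qed.

(** The unrounded value M satisfies 16 M^2 ln X = X^(1+a) exactly. As M >= 2 X^(1/3) >= 200,
    rounding M to x leaves enough room to replace 16 by 10 in one direction and by 32 in the
    other. *)
Lemma part_count_estimates (R : realType) (a X x : R) :
  0 < a -> a < 1 / 3 ->
  1 <= ln X -> 100 <= X `^ a -> 64 * ln X <= X `^ (1 / 3) ->
  `|x - 1 / 4 * (X `^ ((1 + a) / 2) / ln X `^ (1 / 2))| < 1 ->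
  [/\ X `^ (1 / 3) <= x, 10 * x ^+ 2 * ln X <= X * X `^ a
    & X * X `^ a <= 32 * x ^+ 2 * ln X].
Proof.
move=> a0 a3 l1 u100 vl xM.
have X1 : 1 < X.
  by rewrite ltNge; apply/negP => X1; have := ln_le0 X1; lra.
have X0 : 0 < X by lra.
have uv : X `^ a <= X `^ (1 / 3) by apply: ler_powR; exact: ltW.
have v3 : X = X `^ (1 / 3) ^+ 3.
  by rewrite -powR_mulrn ?powR_ge0 // -powRrM [_ * _](_ : _ = 1) ?powRr1 ?ltW
    //; field.
have p2 : X `^ ((1 + a) / 2) ^+ 2 = X * X `^ a.
  have -> : X * X `^ a = X `^ 1 * X `^ a by rewrite powRr1 ?ltW.
  rewrite -powR_mulrn ?powR_ge0 // -powRrM.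
  by rewrite -powRD ?(gt_eqF X0) ?implybT //; congr (_ `^ _); field.
have L2 : ln X `^ (1 / 2) ^+ 2 = ln X.
  by rewrite -powR_mulrn ?powR_ge0 // -powRrM [_ * _](_ : _ = 1) ?powRr1 //;
    [lra|field].
have L0 : 0 < ln X `^ (1 / 2) by apply: powR_gt0; lra.
have p0 : 0 < X `^ ((1 + a) / 2) by exact: powR_gt0.
set M := 1 / 4 * _ in xM.
have M0 : 0 < M by rewrite /M mulr_gt0 // divr_gt0.
have M2 : 16 * M ^+ 2 * ln X = X * X `^ a.
  rewrite -p2 -[in LHS]L2 /M; field; exact: lt0r_neq0.
set u := X `^ a in u100 uv M2 *; set v := X `^ (1 / 3) in vl uv v3 *.
set l := ln X in l1 vl M2 L2 *.
have Mv : 2 * v <= M.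
  rewrite -(@ler_pXn2r _ 2) ?nnegrE //; [|lra|exact: ltW].
  have l0 : 0 < 16 * l by lra.
  rewrite -(ler_pM2r l0) [leRHS](_ : _ = v ^+ 3 * u);
    last by rewrite -v3 -M2; ring.
  have v0 : 0 < v ^+ 2 by rewrite exprn_gt0 //; lra.
  rewrite [leLHS](_ : _ = v ^+ 2 * (64 * l)); last by ring.
  rewrite [leRHS](_ : _ = v ^+ 2 * (v * u)); last by ring.
  by rewrite ler_pM2l //; nra.
move: xM; rewrite ltr_norml => /andP[xM1 xM2].
split; first by lra.
- rewrite -M2; apply: ler_wpM2r; first by lra.
  by nra.
- rewrite -M2; apply: ler_wpM2r; first by lra.
  by nra.
Qed.

(** With v = X^(1/3), the first term is at most x^2/v^4 <= 1/10. For the second, the crude bound 4^t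
    >= t^2 suffices: t >= X/x gives at most x^3/X^2, and (2x)(10x^2) <= v^6 = X^2. *)
Lemma failure_probability (R : realType) (a X x d : R) (t : nat) :
  a < 1 / 3 ->
  1 <= ln X -> 100 <= X `^ a -> 64 * ln X <= X `^ (1 / 3) ->
  X `^ (1 / 3) <= x -> 10 * x ^+ 2 * ln X <= X * X `^ a ->
  X `^ a - 1 <= d -> X <= x * t%:R ->
  x ^+ 2 * expR (- (x^-1 ^+ 2 / 4 * (X * (d - 8)))) + x * (4 ^+ t)^-1 < 1.
Proof.
move=> a3 l1 u100 vl vx x2 du xt.
have X1 : 1 < X.
  by rewrite ltNge; apply/negP => X1; have := ln_le0 X1; lra.
have X0 : 0 < X by lra.
have uv : X `^ a <= X `^ (1 / 3) by apply: ler_powR; exact: ltW.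
have v3 : X = X `^ (1 / 3) ^+ 3.
  by rewrite -powR_mulrn ?powR_ge0 // -powRrM [_ * _](_ : _ = 1) ?powRr1 ?ltW
    //; field.
have lv : ln X = 3 * ln (X `^ (1 / 3)) by rewrite ln_powR; field.
set u := X `^ a in u100 uv x2 du; set v := X `^ (1 / 3) in vl uv v3 vx lv.
have v0 : 0 < v by lra.
have x0 : 0 < x by lra.
have x2v : 10 * x ^+ 2 <= v ^+ 4.
  have h1 : 10 * x ^+ 2 <= 10 * x ^+ 2 * ln X.
    by rewrite ler_peMr // mulr_ge0 // sqr_ge0.
  apply: (le_trans h1); apply: (le_trans x2).
  rewrite [leRHS](_ : _ = v ^+ 3 * v); last by ring.
  by rewrite -v3 ler_wpM2l // ltW.
have E : x ^+ 2 * expR (- (x^-1 ^+ 2 / 4 * (X * (d - 8)))) <= 1 / 10.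
  apply: (@le_trans _ _ (x ^+ 2 * (v ^+ 4)^-1)); last first.
    by rewrite ler_pdivrMr ?exprn_gt0 //; lra.
  rewrite ler_wpM2l ?exprn_ge0 ?(ltW x0) //.
  rewrite -[v in leRHS]lnK ?posrE // -expRM_natl -expRN ler_expR lerN2.
  rewrite [leRHS](_ : _ = X * (d - 8) / (4 * x ^+ 2));
    last by field; exact: lt0r_neq0.
  rewrite ler_pdivlMr; last by rewrite mulr_gt0 ?exprn_gt0.
  (* Rounding gives d - 8 >= u - 9, and u >= 100. *)
  have Xd : X * (91 / 100 * u) <= X * (d - 8) by rewrite ler_pM2l //; lra.
  have := mulr_ge0 (sqr_ge0 x) (le_trans ler01 l1); rewrite lv in x2 *; lra.
have T : x * (4 ^+ t)^-1 <= 1 / 2.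
  have t2 : t%:R ^+ 2 <= 4 ^+ t :> R.
    have -> : 4 = 2 ^+ 2 :> R by rewrite -natrX.
    rewrite -exprM mulnC exprM lerXn2r ?nnegrE ?exprn_ge0 ?ler0n //.
    by rewrite -natrX ler_nat ltnW // ltn_expl.
  have xv : 2 * x <= v ^+ 2.
    rewrite -(@ler_pXn2r _ 2) ?nnegrE ?exprn_ge0 ?mulr_ge0 ?(ltW x0) ?(ltW v0)
      //.
    by rewrite -exprM exprMn; have := sqr_ge0 x; lra.
  rewrite ler_pdivrMr ?exprn_gt0 //.
  apply: (@le_trans _ _ (1 / 2 * t%:R ^+ 2)); last by lra.
  have xx0 : 0 < x ^+ 2 by rewrite exprn_gt0.
  rewrite -(ler_pM2r xx0).
  have h : X ^+ 2 <= (x * t%:R) ^+ 2.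
    by rewrite lerXn2r ?nnegrE ?mulr_ge0 ?(ltW x0) ?(ltW X0).
  have h2 : (2 * x) * (10 * x ^+ 2) <= v ^+ 2 * v ^+ 4.
    by apply: ler_pM => //; rewrite ?mulr_ge0 ?exprn_ge0 ?(ltW x0).
  have h3 : v ^+ 2 * v ^+ 4 = X ^+ 2 by rewrite [in RHS]v3 -exprD -exprM.
  rewrite exprMn in h; have := mulr_ge0 (ltW x0) (ltW xx0).
  by lra.
lra.
Qed.

(** Solves for X in terms of x. From x >= X^(1/3) comes ln X <= 3 ln x, hence X^(1+a)/96 <= x^2 ln x
    with 96 = 32 * 3. Taking the power e = 1/(1+a) <= 1 gives X/96 <= (x^2 ln x)^e, because (1/96)^e
    >= 1/96. Finally k <= 8X/x and 768 = 8 * 96. *)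
Lemma part_size_estimate (R : realType) (a X x k : R) :
  0 < a -> a < 1 / 3 -> 1 <= ln X ->  1 <= x ->
  X `^ (1 / 3) <= x -> X * X `^ a <= 32 * x ^+ 2 * ln X -> k * x <= 8 * X ->
  k <= 768 * x `^ (2 / (1 + a) - 1) * ln x `^ (1 / (1 + a)).
Proof.
move=> a0 a3 l1 x1 vx Xx kx.
have X1 : 1 < X.
  by rewrite ltNge; apply/negP => X1; have := ln_le0 X1; lra.
have X0 : 0 < X by lra.
have x0 : 0 < x by lra.
have e1 : 1 / (1 + a) <= 1 by rewrite ler_pdivrMr; lra.
have e0 : 0 <= 1 / (1 + a) by rewrite divr_ge0; lra.
have lx : ln X <= 3 * ln x.
  have lvx : ln (X `^ (1 / 3)) <= ln x by rewrite ler_ln ?posrE ?powR_gt0.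
  by rewrite ln_powR in lvx; lra.
have x0' : x != 0 by rewrite gt_eqF.
rewrite powRB ?x0' ?implybT // powRr1 ?(ltW x0) //.
have -> : 2 / (1 + a) = 2%:R * (1 / (1 + a)) by field; lra.
rewrite powRrM powR_mulrn ?(ltW x0) //.
set e := 1 / (1 + a) in e0 e1 *.
have lx0 : 0 <= ln x by rewrite ln_ge0.
rewrite [leRHS](_ : _ = 768 * ((x ^+ 2) `^ e * ln x `^ e) / x); last by field.
rewrite ler_pdivlMr //; apply: (le_trans kx).
rewrite -powRM ?sqr_ge0 //.
have XX : 1 / 96 * (X * X `^ a) <= x ^+ 2 * ln x.
  have := ler_wpM2l (sqr_ge0 x) lx; lra.
have -> : 8 * X = 768 * (1 / 96 * X) by field.
rewrite ler_pM2l //; apply: (@le_trans _ _ ((1 / 96 * (X * X `^ a)) `^ e));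
  last first.
  have c0 : 0 <= 1 / 96 * (X * X `^ a).
    by rewrite mulr_ge0 ?divr_ge0 ?ler01 ?ler0n // mulr_ge0 ?powR_ge0 ?(ltW X0).
  by apply: ge0_ler_powR; rewrite ?nnegrE // mulr_ge0 ?sqr_ge0.
have -> : X * X `^ a = X `^ (1 + a).
  by rewrite powRD ?(gt_eqF X0) ?implybT // powRr1 ?ltW.
have c1 : 0 <= 1 / 96 :> R by rewrite divr_ge0 ?ler01 ?ler0n.
rewrite (powRM _ c1 (powR_ge0 _ _)) -powRrM.
have -> : (1 + a) * e = 1 by rewrite /e; field; lra.
rewrite powRr1 ?(ltW X0) // ler_pM2r //.
by apply: ger1_powR; lra.
Qed.

(** * Existence of the minimum f(m, H) and its upper bound *)

Lemma f_is_exists (r : nat) (H : sgraph) (k : nat) :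
  has_free_rk r H k -> exists2 k', f_is r H k' & (k' <= k)%N.
Proof.
elim/ltn_ind: k => k IH hk.
have [[k' [k'k hk']]|nk] :=
    boolp.pselect (exists k', (k' < k)%N /\ has_free_rk r H k').
  have [k'' fk'' le] := IH k' k'k hk'.
  by exists k'' => //; exact: leq_trans le (ltnW k'k).
exists k => //; split=> // k' hk'; rewrite leqNgt; apply/negP => lt.
by apply: nk; exists k'.
Qed.

Local Open Scope classical_set_scope.
Local Open Scope ring_scope.

Theorem theorem3p4 (R : realType) :
  exists C : R, 0 < C /\
    forall (H : sgraph) (a K : R),
      bipartite H ->
      (forall x : H, degree x <> 1%N) ->
      0 < a -> a < 1 / 3 -> 0 < K ->
      infinite_set [set n : nat | good_order H a K n] ->
      exists N : nat, forall n : nat, (N <= n)%N -> good_order H a K n ->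
        forall m : nat,
          rounds m (1 / 4 * (n%:R `^ ((1 + a) / 2) / ln n%:R `^ (1 / 2))) ->
          exists k : nat, f_is m H k /\
            k%:R <= C * m%:R `^ (2 / (1 + a) - 1) * ln m%:R `^ (1 / (1 + a)).
Proof.
exists 768; split=> // H a K _ _ a0 a3 _ _.
pose B : R := Num.max (384 ^+ 6) (100 `^ a^-1).
have B0 : 0 <= B by rewrite le_max exprn_ge0.
exists (Num.bound B) => n Bn [G [d [Gn HG Gd dr _]]] m mr.
have {}Bn : B <= n%:R.
  apply: ltW; apply: (@lt_le_trans _ _ (Num.bound B)%:R);
    last by rewrite ler_nat.
  by have := archi_boundP B0.
have [l1 u100 vl] := large_estimates a0 Bn.
have [vx x2 Xx] := part_count_estimates a0 a3 l1 u100 vl mr.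
have X1 : 1 < n%:R :> R.
  by rewrite ltNge; apply/negP => X1; have := ln_le0 X1; lra.
have uv : n%:R `^ a <= n%:R `^ (1 / 3) :> R by apply: ler_powR; lra.
move: dr; rewrite /rounds ltr_norml => /andP[d1 d2].
have m1 : (1 < m)%N by rewrite -(ltr_nat R); lra.
(* The successor ensures n <= ms, and parts of size 4s still satisfy 4sm <= 4(n + m) <= 8n once m <=
   n. *)
pose s := (n %/ m).+1.
have nms : (n <= m * s)%N by rewrite mulnC ltnW // ltn_ceil // ltnW.
(* Here a < 1/3 enters: d < n^a + 1 <= n^(1/3) + 1 <= m + 1. *)
have dm : (d <= 2 * m)%N by rewrite -(ler_nat R) natrM; lra.
have rk : rk_graph m (4 * s) G.
  apply: (exists_rk_graph (R := R) Gd) => //; rewrite Gn //.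
  apply: failure_probability l1 u100 vl vx x2 _ _ => //; first by lra.
  by rewrite -natrM ler_nat.
have [k fk ks] : exists2 k, f_is m H k & (k <= 4 * s)%N.
  by apply: f_is_exists; split=> //; exists G.
exists k; split=> //; apply: (part_size_estimate a0 a3 l1 _ vx Xx).
  by rewrite ler1n ltnW.
(* Indeed 10 m^2 <= n * n^a <= nm. *)
have mn : (m <= n)%N.
  rewrite -(ler_nat R); set X : R := n%:R in X1 uv vx x2 l1 *.
  set x : R := m%:R in vx x2 *.
  have x1 : 1 <= x by rewrite ler1n ltnW.
  have h1 : 10 * x ^+ 2 <= 10 * x ^+ 2 * ln X.
    by rewrite ler_peMr // mulr_ge0 // sqr_ge0.
  have h2 : X * X `^ a <= X * x by rewrite ler_wpM2l //; lra.
  by nra.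
rewrite -!natrM ler_nat; apply: (@leq_trans (4 * s * m)).
  by rewrite leq_mul2r ks orbT.
rewrite -mulnA -[8%N]/(4 * 2)%N -(mulnA 4%N 2%N n) leq_mul2l /= mul2n -addnn /s mulSn leq_add //.
exact: leq_trunc_div.
Qed.
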